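(* The class of MF spaces is closed under taking $G_\delta$ subspaces: for every poset $P$ and every $G_\delta$ subset $U$ of $\mathrm{MF}(P)$ (i.e. every countable intersection of open sets), there is a poset $Q$ such that $U$, with the subspace topology, is homeomorphic to $\mathrm{MF}(Q)$.
   Context: A poset is a set $P$ with a reflexive, antisymmetric, transitive relation $\preceq$. A filter on $P$ is a nonempty subset $F\subseteq P$ such that (1) for all $p,q\in F$ there is $r\in F$ with $r\preceq p$ and $r\preceq q$, and (2) if $p\in F$, $q\in P$ and $p\preceq q$ then $q\in F$. A filter is maximal if no strictly larger filter contains it. $\mathrm{MF}(P)$ is the set of maximal filters on $P$, with the topology having basis $\{N_p : p\in P\}$, where $N_p=\{F\in \mathrm{MF}(P) : p\in F\}$. An MF space is a space of the form $\mathrm{MF}(P)$ (up to homeomorphism). *)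

(* Defs.v *)
From HB Require Import structures.
From mathcomp Require Import all_boot all_order.
From mathcomp Require Import all_classical topology borel_hierarchy.

Set Implicit Arguments.
Unset Strict Implicit.
Unset Printing Implicit Defensive.

Import Order.TTheory.
Local Open Scope classical_set_scope.
Local Open Scope order_scope.

(* Filters on a poset; not to be confused with the library's [Filter], which
   is about set systems. *)
Definition order_filter d (P : porderType d) (F : set P) : Prop :=
  [/\ F !=set0,
      forall p q : P, F p -> F q -> exists r, [/\ F r, r <= p & r <= q] &
      forall p q : P, F p -> p <= q -> F q].

Definition maximal_order_filter d (P : porderType d) (F : set P) : Prop :=
  order_filter F /\ forall G : set P, order_filter G -> ~ F `<` G.

Record MF d (P : porderType d) := MkMF {
  MF_set :> set P;
  MF_maximal : maximal_order_filter MF_set }.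

HB.instance Definition _ d (P : porderType d) := gen_eqMixin (MF P).
HB.instance Definition _ d (P : porderType d) := gen_choiceMixin (MF P).

Definition MF_basic d (P : porderType d) (p : P) : set (MF P) :=
  [set F : MF P | (F : set P) p].

Lemma MF_basic_cover d (P : porderType d) :
  \bigcup_(B in range (@MF_basic d P)) B = [set: MF P].
Proof.
apply/seteqP; split=> // F _.
have [[[p Fp] _ _] _] := MF_maximal F.
by exists (MF_basic p) => //; exists p.
Qed.

Lemma MF_basic_join d (P : porderType d) (A B : set (MF P)) (F : MF P) :
  range (@MF_basic d P) A -> range (@MF_basic d P) B -> A F -> B F ->
  exists C, [/\ range (@MF_basic d P) C, C F & C `<=` A `&` B].
Proof.
move=> [p _ <-] [q _ <-] Fp Fq.
have [[_ Fdir _] _] := MF_maximal F; have [r [Fr rp rq]] := Fdir p q Fp Fq.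
exists (MF_basic r); split=> //.
move=> G Gr; have [[_ _ Gup] _] := MF_maximal G.
by split; [apply: Gup Gr rp|apply: Gup Gr rq].
Qed.

(* The base is indexed by the sets [MF_basic p] themselves rather than by [P]:
   [isBaseTopological] wants a pointed index type, and [P] may be empty. *)
HB.instance Definition _ d (P : porderType d) :=
  isBaseTopological.Build (MF P) (@MF_basic_cover d P) (@MF_basic_join d P).

Lemma open_MF d (P : porderType d) (U : set (MF P)) :
  open U <-> forall F : MF P, U F ->
    exists2 p : P, (F : set P) p & MF_basic p `<=` U.
Proof.
split=> [[D DN <-] F [B DB BF]|H].
  case: (DN _ DB) => p _ pB; exists p; first by rewrite -pB in BF.
  by move=> G Gp; exists B => //; rewrite -pB.
exists [set B | range (@MF_basic d P) B /\ B `<=` U]; first by move=> B [].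
apply/seteqP; split=> [F [B [_ BU] /BU]//|F /H[p Fp pU]].
by exists (MF_basic p) => //; split=> //; exists p.
Qed.

Definition homeomorphic (X Y : topologicalType) : Prop :=
  exists (f : X -> Y) (g : Y -> X),
    [/\ cancel f g, cancel g f, continuous f & continuous g].

(* Main.v *)
Require Import Defs.
From HB Require Import structures.
From mathcomp Require Import all_boot all_order.
From mathcomp Require Import all_classical topology borel_hierarchy.

(** Let [U] be the intersection of the open sets [A 0, A 1, ...]. Take for [Q]
    the pairs [(n, p)] such that [N_p] is contained in [A i] for all [i < n]
    and meets [U], where going strictly down in [Q] means strictly increasing
    [n] while weakly decreasing [p]. A point [F] of [U] yields the maximal
    filter of all pairs [(n, p)] with [p] in [F]. Conversely let [G] be a
    maximal filter on [Q]. If [n] is bounded on [G], then [G] has a least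
    element [(n, p)], and any point of [U] in [N_p] yields a filter containing
    [G]. Otherwise the second components of [G] generate a filter on [P], and
    any maximal filter extending it lies in every [A i]. *)

Set Implicit Arguments.
Unset Strict Implicit.
Unset Printing Implicit Defensive.

Import Order.TTheory.
Local Open Scope classical_set_scope.
Local Open Scope order_scope.

Lemma MF_inj d (P : porderType d) (F G : MF P) : (F : set P) = G -> F = G.
Proof.
by case: F G => [F mF] [G mG] /= FG; subst G; rewrite (Prop_irrelevance mF mG).
Qed.

Lemma maximal_order_filter_eq d (P : porderType d) (F G : set P) :
  maximal_order_filter F -> order_filter G -> F `<=` G -> F = G.
Proof.
move=> [_ maxF] fG FG; apply/seteqP; split=> //.
by apply: contrapT => GF; apply: (maxF _ fG).
Qed.

Lemma order_filter_sub_MF d (P : porderType d) (F : set P) :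
  order_filter F -> exists M : MF P, F `<=` M.
Proof.
move=> fF; have [[p0 Fp0] Fdir Fup] := fF.
(* Joining [F] makes the union of the empty chain admissible for Zorn. *)
have [C Cchain Ctot|A [fA Amax]] :=
    @Zorn_bigcup P (fun A => order_filter (F `|` A)).
  split; first by exists p0; left.
  - have dirC X p q : C X -> (F `|` X) p -> (F `|` X) q ->
        exists r, [/\ (F `|` \bigcup_(X in C) X) r, r <= p & r <= q].
      move=> CX Xp Xq; have [_ Xdir _] := Cchain _ CX.
      have [r [Xr rp rq]] := Xdir _ _ Xp Xq.
      by exists r; split=> //; case: Xr => [|Xr]; [left|right; exists X].
    move=> p q [Fp|[X CX Xp]] [Fq|[Y CY Yq]].
    + by have [r [Fr rp rq]] := Fdir _ _ Fp Fq; exists r; split=> //; left.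
    + by apply: (dirC Y); [|left|right].
    + by apply: (dirC X); [|right|left].
    + have [XY|YX] := Ctot _ _ CX CY.
        by apply: (dirC Y); [|right; apply: XY|right].
      by apply: (dirC X); [|right|right; apply: YX].
  - move=> p q [Fp|[X CX Xp]] pq; first by left; apply: Fup pq.
    have [_ _ Xup] := Cchain _ CX.
    have [|Fq|Xq] := Xup p q _ pq; [by right|by left|].
    by right; exists X.
have maxFA : maximal_order_filter (F `|` A).
  (* A filter [G] strictly above the union of [F] and [A] absorbs [F], so it is itself a candidate
     for Zorn properly containing [A]. *)
  split=> // G fG [FAG GFA]; apply: (Amax G).
    split; last by move=> GA; apply: GFA => p /GA; right.
    by move=> p Ap; apply: FAG; right.
  by rewrite setUidr // => p Fp; apply: FAG; left.
by exists (MkMF maxFA); apply: subsetUl.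
Qed.

Record approx d (P : porderType d) (A : nat -> set (MF P)) := Approx {
  stage : nat;
  base : P;
  approx_sub : forall i, (i < stage)%N -> MF_basic base `<=` A i;
  approx_meet : MF_basic base `&` \bigcap_i A i !=set0 }.

HB.instance Definition _ d (P : porderType d) (A : nat -> set (MF P)) :=
  gen_eqMixin (approx A).
HB.instance Definition _ d (P : porderType d) (A : nat -> set (MF P)) :=
  gen_choiceMixin (approx A).

Section ApproxOrder.
Context d (P : porderType d) (A : nat -> set (MF P)).

(** Distinct elements of equal stage are incomparable, whatever their bases, so an element of
    highest stage in a filter is its least element. *)
Definition approx_lt (x y : approx A) : bool :=
  (stage y < stage x)%N && (base x <= base y).

Lemma approx_lt_irr : irreflexive approx_lt.
Proof. by move=> x; rewrite /approx_lt ltnn. Qed.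

Lemma approx_lt_trans : transitive approx_lt.
Proof.
move=> y x z /andP[yx xy] /andP[zy yz].
by rewrite /approx_lt (ltn_trans zy yx) (le_trans xy yz).
Qed.

HB.instance Definition _ :=
  Order.Lt_isPOrder.Build d (approx A) approx_lt_irr approx_lt_trans.

Lemma approx_ltE (x y : approx A) :
  (x < y) = (stage y < stage x)%N && (base x <= base y).
Proof. by []. Qed.

Lemma base_le (x y : approx A) : x <= y -> base x <= base y.
Proof. by rewrite (le_eqVlt x) => /predU1P[->//|/andP[]]. Qed.

(** Induction on [n]: openness of the next [A i] gives a basic neighbourhood of [F] inside it, and
    directedness of [F] merges this with the base reached so far. [F] itself witnesses
    [approx_meet]. *)
Lemma approx_exists (n : nat) (F : MF P) (p : P) :
  (forall i, open (A i)) -> (\bigcap_i A i) F -> (F : set P) p ->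
  exists x : approx A,
    [/\ stage x = n, (F : set P) (base x) & base x <= p].
Proof.
move=> oA UF Fp; have [[_ Fdir _] _] := MF_maximal F.
elim: n => [|n [x [<- Fx xp]]].
  have meet0 : MF_basic p `&` \bigcap_i A i !=set0 by exists F.
  have sub0 i : (i < 0)%N -> MF_basic p `<=` A i by [].
  by exists (Approx sub0 meet0).
have [q Fq qA] := (open_MF (A (stage x))).1 (oA _) F (UF _ I).
have [r [Fr rx rq]] := Fdir _ _ Fx Fq.
have sub_r i : (i < (stage x).+1)%N -> MF_basic r `<=` A i.
  move=> ix G Gr; have [[_ _ Gup] _] := MF_maximal G.
  move: ix; rewrite ltnS leq_eqVlt => /predU1P[->|ix].
    by apply: qA; apply: Gup rq.
  by apply: (approx_sub ix); apply: Gup rx.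
have meet_r : MF_basic r `&` \bigcap_i A i !=set0 by exists F.
by exists (Approx sub_r meet_r); split=> //=; apply: le_trans xp.
Qed.

Definition approx_filter (F : set P) : set (approx A) := [set x | F (base x)].

Lemma order_filter_approx (F : MF P) :
  (forall i, open (A i)) -> (\bigcap_i A i) F -> order_filter (approx_filter F).
Proof.
move=> oA UF; have [[[p Fp] Fdir Fup] _] := MF_maximal F; split.
- by have [x [_ Fx _]] := approx_exists 0 oA UF Fp; exists x.
- move=> x y Fx Fy; have [r [Fr rx ry]] := Fdir _ _ Fx Fy.
  (* A stage above both makes [z] strictly smaller than [x] and [y], since its base lies below
     theirs. *)
  have [z [zn Fz zr]] := approx_exists (maxn (stage x) (stage y)).+1 oA UF Fr.
  exists z; split=> //; apply: ltW; rewrite approx_ltE zn ltnS.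
    by rewrite leq_maxl (le_trans zr).
  by rewrite leq_maxr (le_trans zr).
- by move=> x y Fx /base_le; apply: Fup.
Qed.

Lemma order_filter_base (G : set (approx A)) :
  order_filter G -> order_filter [set p | exists2 x, G x & base x <= p].
Proof.
move=> [[x Gx] Gdir Gup]; split; first by exists (base x), x.
- move=> p q [y Gy yp] [z Gz zq]; have [t [Gt ty tz]] := Gdir _ _ Gy Gz.
  exists (base t); split; first by exists t.
    exact: le_trans (base_le ty) yp.
  exact: le_trans (base_le tz) zq.
- by move=> p q [y Gy yp] pq; exists y => //; apply: le_trans pq.
Qed.

(** A larger filter [G] projects to a filter on [P] that contains [F], hence equals it; so all bases
    of [G] lie in [F]. *)
Lemma maximal_approx_filter (F : MF P) :
  (forall i, open (A i)) -> (\bigcap_i A i) F ->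
  maximal_order_filter (approx_filter F).
Proof.
move=> oA UF; split; first exact: order_filter_approx.
move=> G fG [FG]; apply => x Gx; rewrite /approx_filter /=.
rewrite (maximal_order_filter_eq (MF_maximal F) (order_filter_base fG)).
  by exists x.
by move=> p Fp; have [y [_ Fy yp]] := approx_exists 0 oA UF Fp; exists y;
  [apply: FG|].
Qed.

Lemma order_filter_bounded_min (G : set (approx A)) (n : nat) :
  order_filter G -> (forall x, G x -> (stage x <= n)%N) ->
  exists2 x, G x & forall y, G y -> x <= y.
Proof.
move=> [[x0 Gx0] Gdir _].
elim: n x0 Gx0 => [|n IH] x Gx bnd.
  exists x => // y Gy; have [z [Gz + zy]] := Gdir _ _ Gx Gy.
  rewrite le_eqVlt => /predU1P[<-//|/andP[xz _]].
  by move: xz; rewrite ltnNge (leq_trans (bnd _ Gz)).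
(* An element of stage [n.+1] is least: its common lower bound with any [t] cannot have a higher
   stage. If there is none, the bound drops to [n]. *)
have [[y Gy yn]|nG] := pselect (exists2 y, G y & stage y = n.+1).
  exists y => // t Gt; have [z [Gz + zt]] := Gdir _ _ Gy Gt.
  rewrite le_eqVlt => /predU1P[<-//|/andP[yz _]].
  by move: yz; rewrite yn ltnNge bnd.
apply: (IH x) => // y Gy; have := bnd y Gy.
by rewrite leq_eqVlt => /predU1P[yn|//]; case: nG; exists y.
Qed.

Lemma approx_filter_cover (G : set (approx A)) :
  order_filter G ->
  exists2 F : MF P, (\bigcap_i A i) F & G `<=` approx_filter F.
Proof.
move=> fG.
have [[n bnd]|unb] := pselect (exists n, forall x, G x -> (stage x <= n)%N).
  have [x Gx xmin] := order_filter_bounded_min fG bnd.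
  have [F [Fx UF]] := approx_meet x; exists F => // y /xmin /base_le xy.
  by have [[_ _ Fup] _] := MF_maximal F; apply: Fup xy.
have [F FG] := order_filter_sub_MF (order_filter_base fG).
have GF : G `<=` approx_filter F by move=> x Gx; apply: FG; exists x.
(* If [F] missed [A i], then [i] would bound the stages on [G]: a stage above [i] puts the basic set
   of the base, and with it [F], inside [A i]. *)
exists F => // i _; apply: contrapT => nFi; apply: unb; exists i => x Gx.
by rewrite leqNgt; apply/negP => /approx_sub xi; apply/nFi/xi/GF.
Qed.

End ApproxOrder.

Theorem theorem4p3 (d : Order.disp_t) (P : porderType d) (U : set (MF P)) :
  Gdelta U ->
  exists (d' : Order.disp_t) (Q : porderType d'),
    homeomorphic (set_type U) (MF Q).
Proof.
move=> [A oA UA]; exists d, (approx A).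
have inU (F : set_type U) : (\bigcap_i A i) (set_val F).
  by rewrite -UA; apply: set_valP.
pose f (F : set_type U) : MF (approx A) :=
  MkMF (maximal_approx_filter oA (inU F)).
have f_surj (G : MF (approx A)) : exists F, f F = G.
  have [F UF GF] := approx_filter_cover (MF_maximal G).1; rewrite -UA in UF.
  exists (SigSub (mem_set UF)); apply: MF_inj; apply/esym.
  apply: maximal_order_filter_eq GF; first exact: MF_maximal.
  by apply: order_filter_approx => //; rewrite -UA.
(* Every [p] in [F] lies above the base of some element of [f F], so [f F] determines [F]. *)
have f_sub (F F' : set_type U) :
      f F = f F' -> (set_val F : set P) `<=` set_val F'.
  move=> FF' p Fp; have [x [_ Fx xp]] := approx_exists 0 oA (inU F) Fp.
  have : (f F : set (approx A)) x by [].
  rewrite FF' => F'x; have [[_ _ F'up] _] := MF_maximal (set_val F').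
  exact: F'up xp.
have f_inj : injective f.
  by move=> F F' FF'; apply/val_inj/MF_inj/seteqP; split; apply: f_sub.
have [g gK] := choice f_surj.
exists f, g; split=> //.
- by move=> F; apply: f_inj; rewrite gK.
- move=> F W; rewrite nbhsE => -[V [oV VF] VW].
  (* The trace on [U] of [MF_basic (base x)] is the preimage under [f] of [MF_basic x]. *)
  have [x Fx xV] := (open_MF V).1 oV _ VF.
  have : nbhs (set_val F) (MF_basic (base x)).
    apply: open_nbhs_nbhs; split; last exact: Fx.
    by apply: (open_MF _).2 => H Hx; exists (base x).
  move=> /(@initial_continuous _ _ (@set_val _ U) F) nbF.
  by apply: (@filterS _ (nbhs F) _ _ _ _ nbF) => H Hx; apply/VW/xV.
- apply: (@continuous_comp_initial _ (MF (approx A)) _ (@set_val _ U) g).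
  apply/continuousP => W /open_MF oW.
  apply: (open_MF _).2 => G /oW[p Gp pW].
  (* An element of [G] with base below [p] gives a basic neighbourhood of [G] that [g] sends into
     [MF_basic p]. *)
  have [x [_ Gx xp]] := approx_exists 0 oA (inU (g G)) Gp.
  exists x; first by rewrite -(gK G).
  move=> H; rewrite -{1}(gK H) => Hx; apply: pW.
  have [[_ _ Hup] _] := MF_maximal (set_val (g H)).
  exact: Hup xp.
Qed.
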